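(* Let $A\subseteq\omega$ be an infinite c.e. set, let $\theta$ be a quasi-Gödel numbering of $\mathcal S^{(1)}_A$ and let $\varphi$ be a Gödel numbering of $\mathcal P^{(1)}$. Then $(\mathcal S^{(1)}_A,\theta)$ is a retract of $(\mathcal P^{(1)},\varphi)$.
   Context: $\omega$ is the set of natural numbers; $\mathcal P^{(n)}$ and $\mathcal R^{(n)}$ are the sets of $n$-ary partial, respectively total, computable functions on $\omega$. $\langle\cdot,\cdot\rangle:\omega^2\to\omega$ is a computable bijection with $\langle x,y\rangle\ge x,y$. $\mathrm{Anf}^{(1)}_A$ is the set of partial functions from $\omega$ to $\omega$ whose domain is either empty or equal to $\{0,\dots,a-1\}$ for some $a\in A$, and $\mathcal S^{(1)}_A=\mathcal R^{(1)}\cup\mathrm{Anf}^{(1)}_A$. The extended graph of a unary partial function $q$ is $\{\langle y,0\rangle:y\in\omega\}\cup\{\langle x,q(x)+1\rangle:x\in\mathrm{dom}(q)\}$; that of a binary partial function $q$ is $\{\langle\langle y,y'\rangle,0\rangle:y,y'\in\omega\}\cup\{\langle\langle x,x'\rangle,q(x,x')+1\rangle:(x,x')\in\mathrm{dom}(q)\}$. A numbering of a set $X$ is a surjection $\omega\to X$. A numbering $\theta$ of $\mathcal S^{(1)}_A$ is a quasi-Gödel numbering if: (QGN I) the extended graph of $(i,x)\mapsto\theta_i(x)$ is the range of a function in $\mathcal R^{(1)}$; and (QGN II) for every $k\in\mathcal R^{(2)}$ there is $v\in\mathcal R^{(1)}$ such that for all $i\in\omega$, $r\in\mathcal S^{(1)}_A$: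 if $\{k(i,t):t\in\omega\}$ is the extended graph of $r$, then $r=\theta_{v(i)}$. A Gödel numbering of $\mathcal P^{(1)}$ is a numbering $\varphi$ with partial computable universal function $(i,x)\mapsto\varphi_i(x)$ such that for every $g\in\mathcal P^{(2)}$ there is $s\in\mathcal R^{(1)}$ with $\varphi_{s(i)}(x)=g(i,x)$ for all $i,x$. For $Z\subseteq\mathcal P^{(1)}$ with a numbering $\zeta$, $(Z,\zeta)$ is a retract of $(\mathcal P^{(1)},\varphi)$ if (a) $\zeta\le_m\varphi$, i.e. $\zeta=\varphi\circ g$ for some $g\in\mathcal R^{(1)}$, and (b) there are an idempotent map $H$ from $\mathcal P^{(1)}$ onto $Z$ and some $h\in\mathcal R^{(1)}$ such that $H(\varphi_i)=\zeta_{h(i)}$ for all $i\in\omega$. *)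

(* Defs.v *)
From mathcomp Require Import all_boot.
From mathcomp Require Import classical_sets cardinality.

Set Implicit Arguments.
Unset Strict Implicit.
Unset Printing Implicit Defensive.

Local Open Scope classical_set_scope.
Local Open Scope nat_scope.

(* Computability is Kleene's: [mu_code n] are the definitions of [n]-ary partial
   recursive functions from zero, successor and projections by composition,
   primitive recursion and unbounded minimization. *)
Inductive mu_code : nat -> Type :=
| Zero n : mu_code n
| Succ : mu_code 1
| Proj n (i : 'I_n) : mu_code n
| Comp n k (f : mu_code k) (g : 'I_k -> mu_code n) : mu_code n
| PrimRec n (f : mu_code n) (g : mu_code n.+2) : mu_code n.+1
| Mu n (f : mu_code n.+1) : mu_code n.

(* [eval c s y]: the function defined by [c] has value [y] at the argument list
   [s].  This is meaningful only when [size s] is the arity of [c]; the defaults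
   of [nth] and [head] are never reached in that case.  The recursion and the
   minimization variable come first. *)
Fixpoint eval n (c : mu_code n) : seq nat -> nat -> Prop :=
  match c with
  | Zero _ => fun _ y => y = 0
  | Succ => fun s y => y = (head 0 s).+1
  | Proj _ i => fun s y => y = nth 0 s i
  | Comp _ k f g => fun s y =>
      exists t : k.-tuple nat, (forall j, eval (g j) s (tnth t j)) /\ eval f t y
  | PrimRec _ f g => fun s =>
      nat_rect (fun=> nat -> Prop)
        (eval f (behead s))
        (fun m value_at_m y =>
           exists z, value_at_m z /\ eval g [:: m, z & behead s] y)
        (head 0 s)
  | Mu _ f => fun s y =>
      eval f (y :: s) 0 /\
      (forall m, m < y -> exists z, eval f (m :: s) z.+1)
  end.

(* [None] stands for "undefined". *)
Definition partial1 := nat -> option nat.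
Definition partial2 := nat -> nat -> option nat.

Definition P1 : set partial1 :=
  [set q | exists c : mu_code 1,
      forall x y, q x = Some y <-> eval c [:: x] y].
Definition P2 : set partial2 :=
  [set q | exists c : mu_code 2,
      forall x x' y, q x x' = Some y <-> eval c [:: x; x'] y].
Definition R1 : set (nat -> nat) := [set f | P1 (fun x => Some (f x))].
Definition R2 : set (nat -> nat -> nat) :=
  [set f | P2 (fun x x' => Some (f x x'))].

Definition pdom (q : partial1) : set nat := [set x | isSome (q x)].

Definition computably_enumerable (A : set nat) : Prop :=
  A = set0 \/ exists f, R1 f /\ range f = A.

Definition pairing (pr : nat -> nat -> nat) : Prop :=
  [/\ R2 pr,
      bijective (fun p : nat * nat => pr p.1 p.2)
    & forall x y, x <= pr x y /\ y <= pr x y].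

Definition Anf1 (A : set nat) : set partial1 :=
  [set q | pdom q = set0 \/ exists a, A a /\ pdom q = `I_a].

Definition S1 (A : set nat) : set partial1 :=
  [set q | exists f, R1 f /\ q = (fun x => Some (f x))] `|` Anf1 A.

Definition extended_graph1 (pr : nat -> nat -> nat) (q : partial1) : set nat :=
  [set pr y 0 | y in setT] `|`
  [set z | exists x v, q x = Some v /\ z = pr x v.+1].

Definition extended_graph2 (pr : nat -> nat -> nat) (q : partial2) : set nat :=
  [set z | exists y y', z = pr (pr y y') 0] `|`
  [set z | exists x x' v, q x x' = Some v /\ z = pr (pr x x') v.+1].

(* A sequence of unary partial functions is, up to conversion, also its own
   universal function [partial2]; this is used below. *)
Definition numbering (X : set partial1) (theta : nat -> partial1) : Prop :=
  range theta = X.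

Definition quasi_Goedel_numbering (pr : nat -> nat -> nat) (A : set nat)
    (theta : nat -> partial1) : Prop :=
  [/\ numbering (S1 A) theta,
      exists f, R1 f /\ range f = extended_graph2 pr theta
    & forall k, R2 k -> exists v, R1 v /\
        forall i r, S1 A r ->
          range (k i) = extended_graph1 pr r -> r = theta (v i)].

Definition Goedel_numbering (phi : nat -> partial1) : Prop :=
  [/\ numbering P1 phi,
      P2 phi
    & forall g, P2 g -> exists s, R1 s /\ forall i x, phi (s i) x = g i x].

Definition m_reducible (zeta phi : nat -> partial1) : Prop :=
  exists g, R1 g /\ zeta = phi \o g.

(* [H] is a map on [P1]; its values outside [P1] are irrelevant. *)
Definition retract (Z : set partial1) (zeta phi : nat -> partial1) : Prop :=
  m_reducible zeta phi /\
  exists (H : partial1 -> partial1) (h : nat -> nat),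
    [/\ H @` P1 = Z,
        forall q, P1 q -> H (H q) = H q,
        R1 h
      & forall i, H (phi i) = zeta (h i)].

(* Main.v *)
(** Let [H q] be the union of the restrictions of [q] to [{0, ..., a-1}], over
    all [a] in [A] such that [q] is defined on the whole of [{0, ..., a-1}].
    Since [A] is infinite, [H] fixes the total functions, and it clearly fixes
    the members of [Anf1 A].  The graph of [H (phi i)] can be enumerated
    uniformly in [i], because [A] is c.e. and every partial recursive function
    is the increasing limit of a recursive sequence of finite stages, so
    (QGN II) provides [h].  Conversely (QGN I) makes the universal function of
    [theta] partial recursive, whence [theta] reduces to [phi]. *)
Require Import Defs.
From mathcomp Require Import all_boot.
From mathcomp Require Import boolp classical_sets cardinality.

Set Implicit Arguments.
Unset Strict Implicit.
Unset Printing Implicit Defensive.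

Local Open Scope classical_set_scope.
Local Open Scope nat_scope.

(** * Total recursive functions of argument lists *)

(** Only lists of length [n] are constrained, so functions can be written as plain terms in
    [nth 0 s i] and exchanged by [recursive_ext]. Predicates enter as 0/1-valued functions through
    the coercion of booleans. *)
Definition recursive n (F : seq nat -> nat) : Prop :=
  exists c : mu_code n,
    forall s, size s = n -> forall y, eval c s y <-> y = F s.

Lemma recursive_ext n F F' :
  (forall s, size s = n -> F s = F' s) -> recursive n F -> recursive n F'.
Proof. by move=> eqF [c cF]; exists c => s ss y; rewrite cF // eqF. Qed.

Lemma recursive_nth n i : i < n -> recursive n (fun s => nth 0 s i).
Proof. by move=> lt_in; exists (Proj (Ordinal lt_in)). Qed.

Lemma recursive_comp n F (gs : seq (seq nat -> nat)) :
    recursive (size gs) F ->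
    (forall j, j < size gs -> recursive n (nth (fun=> 0) gs j)) ->
  recursive n (fun s => F [seq g s | g <- gs]).
Proof.
move=> [f fF] gsP.
have /fin_all_exists[g gP] (j : 'I_(size gs)) := gsP j (ltn_ord j).
exists (Comp f g) => s ss y /=.
have sz : size [seq h s | h <- gs] == size gs by rewrite size_map.
split=> [[t [tP /fF]]|->].
  rewrite size_tuple => /(_ erefl) ->; congr F.
  apply: (@eq_from_nth _ 0) => [|i]; rewrite size_tuple ?size_map // => lt_i.
  rewrite (nth_map (fun=> 0)) //.
  by move: (tP (Ordinal lt_i)) => /gP; rewrite (tnth_nth 0) => /(_ ss).
exists (Tuple sz); split=> [j|]; last by apply/fF; rewrite ?size_map.
by apply/gP; rewrite // (tnth_nth 0) /= (nth_map (fun=> 0)).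
Qed.

Lemma recursive_const n k : recursive n (fun=> k).
Proof.
elim: k => [|k [c ck]]; first by exists (Zero n).
apply: (@recursive_comp n (fun s => (head 0 s).+1) [:: fun=> k]).
  by exists Succ.
by case=> // _; exists c.
Qed.

Lemma recursive_succ n E : recursive n E -> recursive n (fun s => (E s).+1).
Proof.
move=> rE; apply: (@recursive_comp n (fun s => (head 0 s).+1) [:: E]).
  by exists Succ.
by case.
Qed.

(** Composition with projections; serves to permute arguments and to insert dummy ones. *)
Lemma recursive_rename n m (r : nat -> nat) F :
    recursive m F -> (forall i, i < m -> r i < n) ->
  recursive n (fun s => F [seq nth 0 s (r i) | i <- iota 0 m]).
Proof.
move=> rF rP.
have szP : size [seq (fun s : seq nat => nth 0 s (r i)) | i <- iota 0 m] = m.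
  by rewrite size_map size_iota.
have: recursive n (fun s => F [seq g s | g <-
         [seq (fun s : seq nat => nth 0 s (r i)) | i <- iota 0 m]]).
  apply: recursive_comp => [|j]; rewrite szP // => lt_jm.
  rewrite (nth_map 0) ?size_iota // nth_iota // add0n.
  exact/recursive_nth/rP.
by apply: recursive_ext => s _; rewrite -map_comp.
Qed.

Lemma recursive_behead n E :
  recursive n E -> recursive n.+1 (fun s => E (behead s)).
Proof.
move=> rE; have := @recursive_rename n.+1 n S E rE (fun i => id).
apply: recursive_ext => -[|x s] //= [ss]; congr E.
by rewrite -ss -/(mkseq _ _) mkseq_nth.
Qed.

Lemma recursive_subst n G E :
  recursive n.+1 G -> recursive n E -> recursive n (fun s => G (E s :: s)).
Proof.
move=> rG rE.
set gs := E :: [seq (fun s : seq nat => nth 0 s i) | i <- iota 0 n].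
have szP : size gs = n.+1 by rewrite /= size_map size_iota.
have: recursive n (fun s => G [seq g s | g <- gs]).
  apply: recursive_comp => [|[|j]]; rewrite szP //= ltnS => lt_jn.
  rewrite (nth_map 0) ?size_iota // nth_iota // add0n.
  exact/recursive_nth.
apply: recursive_ext => s ss /=; congr (G (_ :: _)).
by rewrite -map_comp -ss -/(mkseq _ _) mkseq_nth.
Qed.

Lemma recursive_app1 n f E :
  recursive 1 (fun s => f (nth 0 s 0)) -> recursive n E ->
  recursive n (fun s => f (E s)).
Proof. by move=> rf rE; apply: (@recursive_comp n _ [:: E] rf); case. Qed.

Lemma recursive_app2 n f E1 E2 :
  recursive 2 (fun s => f (nth 0 s 0) (nth 0 s 1)) ->
  recursive n E1 -> recursive n E2 -> recursive n (fun s => f (E1 s) (E2 s)).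
Proof.
by move=> rf r1 r2; apply: (@recursive_comp n _ [:: E1; E2] rf); case=> [|[]].
Qed.

Lemma recursive_rect n E F G :
    recursive n E -> recursive n F -> recursive n.+2 G ->
  recursive n (fun s =>
    nat_rect (fun=> nat) (F s) (fun m z => G [:: m, z & s]) (E s)).
Proof.
move=> rE [f fF] [g gG].
(* [PrimRec] recurses on the first argument, so that argument is kept free and [E s] is substituted
   for it afterwards. *)
apply: (@recursive_subst n (fun s => nat_rect (fun=> nat) (F (behead s))
  (fun m z => G [:: m, z & behead s]) (head 0 s)) E) => //.
exists (PrimRec f g) => -[|x s] //= [ss].
elim: x => [|x IHx] y /=; first exact: fF.
split=> [[z [/IHx ->]]|->]; first by rewrite gG //= ss.
by eexists; split; [exact/IHx | apply/gG => //=; rewrite ss].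
Qed.

(** * Arithmetic, truth values, bounded sums and bounded quantifiers *)

Lemma recursive_add n E1 E2 :
  recursive n E1 -> recursive n E2 -> recursive n (fun s => E1 s + E2 s).
Proof.
move=> r1 r2.
have r3 := recursive_succ (@recursive_nth n.+2 1 isT).
apply: recursive_ext (recursive_rect r1 r2 r3) => s _ /=.
by elim: (E1 s) => //= x ->.
Qed.

Lemma recursive_mul n E1 E2 :
  recursive n E1 -> recursive n E2 -> recursive n (fun s => E1 s * E2 s).
Proof.
move=> r1 r2; have r3 := recursive_add
  (recursive_behead (recursive_behead r2)) (@recursive_nth n.+2 1 isT).
apply: recursive_ext (recursive_rect r1 (recursive_const n 0) r3) => s _ /=.
by elim: (E1 s) => //= x ->; rewrite mulSn.
Qed.

Lemma recursive_pred n E : recursive n E -> recursive n (fun s => (E s).-1).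
Proof.
move=> rE; have r3 := @recursive_nth n.+2 0 isT.
apply: recursive_ext (recursive_rect rE (recursive_const n 0) r3) => s _ /=.
by case: (E s).
Qed.

Lemma recursive_sub n E1 E2 :
  recursive n E1 -> recursive n E2 -> recursive n (fun s => E1 s - E2 s).
Proof.
move=> r1 r2; have r3 := recursive_pred (@recursive_nth n.+2 1 isT).
apply: recursive_ext (recursive_rect r2 r1 r3) => s _ /=.
by elim: (E2 s) => [|x /= ->]; rewrite ?subn0 ?subnS.
Qed.

(** Subtraction is truncated: [1 - (x - y)] is 1 if [x <= y], and 0 otherwise. *)
Lemma recursive_leq n E1 E2 :
  recursive n E1 -> recursive n E2 -> recursive n (fun s => E1 s <= E2 s).
Proof.
move=> r1 r2.
apply: recursive_ext (recursive_sub (recursive_const n 1) (recursive_sub r1 r2)).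
by move=> s _; rewrite -subn_eq0; case: (E1 s - E2 s).
Qed.

Lemma recursive_and n (b1 b2 : seq nat -> bool) :
    recursive n (fun s => b1 s) -> recursive n (fun s => b2 s) ->
  recursive n (fun s => b1 s && b2 s).
Proof.
by move=> r1 r2; apply: recursive_ext (recursive_mul r1 r2) => s _; rewrite mulnb.
Qed.

Lemma recursive_eq n E1 E2 :
  recursive n E1 -> recursive n E2 -> recursive n (fun s => E1 s == E2 s).
Proof.
move=> r1 r2.
apply: recursive_ext (recursive_and (recursive_leq r1 r2) (recursive_leq r2 r1)).
by move=> s _; rewrite eqn_leq.
Qed.

(** In a recursion step the accumulator sits at position 1. A dummy argument inserted there adapts a
    summand or a bounded predicate, which does not look at the accumulator. *)
Lemma recursive_bump n G :
  recursive n.+1 G -> recursive n.+2 (fun s => G (head 0 s :: behead (behead s))).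
Proof.
move=> rG.
have := @recursive_rename n.+2 n.+1 (fun i => if i is j.+1 then j.+2 else 0) G rG.
move=> /(_ _)/recursive_ext; apply; last by case.
move=> [|x [|y s]] //= [ss]; congr (G (_ :: _)).
rewrite -[1]/(1 + 0) iotaDl -map_comp -ss.
exact: mkseq_nth.
Qed.

Lemma recursive_sum n E G : recursive n E -> recursive n.+1 G ->
  recursive n (fun s => \sum_(y < E s) G (nat_of_ord y :: s)).
Proof.
move=> rE /recursive_bump rG.
have r3 := recursive_add (@recursive_nth n.+2 1 isT) rG.
apply: recursive_ext (recursive_rect rE (recursive_const n 0) r3) => s _ /=.
by elim: (E s) => [|x IHx]; rewrite ?big_ord0 // big_ord_recr /= -IHx.
Qed.

Lemma recursive_all n E (b : seq nat -> bool) :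
    recursive n E -> recursive n.+1 (fun s => b s) ->
  recursive n (fun s => all (fun y => b (y :: s)) (iota 0 (E s))).
Proof.
move=> rE /recursive_bump rb.
have r3 := recursive_mul (@recursive_nth n.+2 1 isT) rb.
apply: recursive_ext (recursive_rect rE (recursive_const n 1) r3) => s _ /=.
elim: (E s) => // x IHx; rewrite [LHS]/= IHx mulnb.
by rewrite -[in RHS]addn1 iotaD all_cat /= add0n andbT.
Qed.

(** Only the term at the unique witness [y] survives. Together with [recursive_sum] this makes
    bounded search for a unique witness recursive. *)
Lemma sum_single m (b : nat -> bool) (w : nat -> nat) y :
    y < m -> b y -> (forall z, z < m -> b z -> z = y) ->
  \sum_(i < m) b i * w i = w y.
Proof.
move=> lt_ym by_ uniq_y; rewrite (bigD1 (Ordinal lt_ym)) //= by_ mul1n.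
rewrite big1 ?addn0 // => i /eqP ne_iy.
case: (boolP (b i)) => // /uniq_y eq_iy; case: ne_iy.
by apply/val_inj; rewrite /= eq_iy.
Qed.

Lemma R1P f : R1 f <-> recursive 1 (fun s => f (nth 0 s 0)).
Proof.
split=> [[c cf]|[c cf]]; exists c.
  move=> [|x []] //= _ y; rewrite -cf.
  by split=> [[]|->].
by move=> x y; rewrite cf //=; split=> [[]|->].
Qed.

Lemma R2P f : R2 f <-> recursive 2 (fun s => f (nth 0 s 0) (nth 0 s 1)).
Proof.
split=> [[c cf]|[c cf]]; exists c.
  move=> [|x [|x' []]] //= _ y; rewrite -cf.
  by split=> [[]|->].
by move=> x x' y; rewrite cf //=; split=> [[]|->].
Qed.

(** * Finite stages of partial recursive functions *)

(* [F (m :: s)] is the [m]-th stage of the partial function [q] at [s]: [0] when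
   no value has been found yet, and [y.+1] when the value [y] has been found. *)
Definition approximates n (F : seq nat -> nat) (q : seq nat -> nat -> Prop) :=
  recursive n.+1 F /\ forall s, size s = n ->
    (forall m m' y, m <= m' -> F (m :: s) = y.+1 -> F (m' :: s) = y.+1) /\
    (forall y, q s y <-> exists m, F (m :: s) = y.+1).

Lemma approximates_total n F q :
    recursive n F -> (forall s, size s = n -> forall y, q s y <-> y = F s) ->
  approximates n (fun s => (F (behead s)).+1) q.
Proof.
move=> rF qF; split; first exact/recursive_succ/recursive_behead.
move=> s ss; split=> // y; rewrite qF //=.
by split=> [->|[_ []]]; first exists 0.
Qed.

(** As the conditions persist at later stages, the maximum of finitely many stages serves them
    all. *)
Lemma common_stage (P : nat -> nat -> Prop) k :
    (forall m m' j, m <= m' -> P m j -> P m' j) ->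
    (forall j, j < k -> exists m, P m j) ->
  exists m, forall j, j < k -> P m j.
Proof.
move=> monoP; elim: k => [|k IHk] exP; first by exists 0.
have [j lt_jk|m mP] := IHk; first exact/exP/ltnW.
have [m' m'P] := exP k (ltnSn k).
exists (maxn m m') => j; rewrite ltnS leq_eqVlt => /predU1P[->|/mP].
  exact: monoP (leq_maxr _ _) m'P.
exact/monoP/leq_maxl.
Qed.

(** Stage [m] runs every [g j] to stage [m], then [f] to stage [m] on the values found. Once all
    [g j] have answered, their values no longer change, so monotonicity in [m] passes to the
    composite. *)
Lemma approximates_comp n k (f : mu_code k) (g : 'I_k -> mu_code n) F G :
    approximates k F (eval f) -> (forall j, approximates n (G j) (eval (g j))) ->
  exists F', approximates n F' (eval (Comp f g)).
Proof.
move=> [rF FP] GP.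
(* The predecessor strips the successor that marks a found value. Where nothing has been found it
   gives a spurious 0, which the factor [ok] cancels. *)
pose vals s := [seq (G j s).-1 | j <- enum 'I_k].
pose ok s := all (fun j => 0 < G j s) (enum 'I_k).
exists (fun s => ok s * F (head 0 s :: vals s)); split.
  apply: recursive_mul.
    rewrite /ok; elim: (enum 'I_k) => [|j js IHjs] /=.
      exact: (recursive_const _ 1).
    apply: (recursive_and (b1 := fun s => 0 < G j s)) => //.
    by apply: (recursive_leq (recursive_const _ 1)); have [] := GP j.
  pose gs := (fun s => nth 0 s 0) ::
             [seq (fun s => (G j s).-1) | j <- enum 'I_k].
  have szP : size gs = k.+1 by rewrite /= size_map size_enum_ord.
  have: recursive n.+1 (fun s => F [seq g s | g <- gs]).
    apply: recursive_comp => [|[|j]]; rewrite szP //= => lt_jk.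
      exact: recursive_nth.
    rewrite ltnS in lt_jk.
    rewrite (nth_map (Ordinal lt_jk)) ?size_enum_ord //.
    by apply: recursive_pred; have [] := GP (nth (Ordinal lt_jk) (enum 'I_k) j).
  apply: recursive_ext => s _ /=; rewrite nth0; congr (F (_ :: _)).
  by rewrite -map_comp.
move=> s ss.
have szv m : size (vals (m :: s)) = k by rewrite size_map size_enum_ord.
have monoG j := (proj2 (GP j) s ss).1.
have okP m : reflect (forall j, exists z, G j (m :: s) = z.+1) (ok (m :: s)).
  apply: (iffP allP) => [okm j|okm j _]; last by have [z ->] := okm j.
  have /okm := mem_enum 'I_k j.
  by case: (G j _) => // z _; exists z.
have ok_mono m m' : m <= m' -> ok (m :: s) ->
    ok (m' :: s) /\ vals (m' :: s) = vals (m :: s).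
  move=> le_mm' /okP okm; split.
    by apply/okP => j; have [z /(monoG _ _ _ _ le_mm')] := okm j; exists z.
  apply: eq_map => j.
  by have [z zP] := okm j; rewrite (monoG _ _ _ _ le_mm' zP) zP.
split=> [m m' y le_mm' /=|y /=].
  case: (boolP (ok _)) => // okm; rewrite mul1n => Fy.
  have [-> ->] := ok_mono _ _ le_mm' okm; rewrite mul1n.
  exact: ((FP _ (szv m)).1 _ _ _ le_mm' Fy).
split=> [[t [tP ft]]|[m]].
  (* [common_stage] is indexed by numbers [j], the codes [g] by ordinals; quantifying over the [i]
     with value [j] bridges the two. *)
  have [m m' j le_mm' mP i ei|j lt_jk|m mP] := @common_stage (fun m j => forall i : 'I_k,
      i = j :> nat -> G i (m :: s) = (tnth t i).+1) k.
  - exact: monoG le_mm' (mP i ei).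
  - have [_ /(_ s ss)[_ /(_ (tnth t (Ordinal lt_jk)))[]]] := GP (Ordinal lt_jk).
    move=> /(_ (tP _))[m mP] _; exists m => i ei.
    by have -> : i = Ordinal lt_jk by apply/val_inj.
  have [monoF /(_ y)[/(_ ft)[m' m'P] _]] := FP t (size_tuple t).
  have okm : ok (m :: s).
    by apply/okP => j; exists (tnth t j); apply: mP (ltn_ord j) _ _.
  have valsm : vals (m :: s) = t.
    apply: (@eq_from_nth _ 0) => [|i]; rewrite szv ?size_tuple // => lt_ik.
    rewrite (nth_map (Ordinal lt_ik)) ?size_enum_ord //.
    rewrite (mP i lt_ik); last by rewrite nth_enum_ord.
    by rewrite (tnth_nth 0) nth_enum_ord.
  exists (maxn m m').
  have [-> ->] := ok_mono _ _ (leq_maxl m m') okm.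
  by rewrite valsm mul1n; apply: monoF m'P; apply: leq_maxr.
case: (boolP (ok _)) => // okm; rewrite mul1n => Fy.
have szt : size (vals (m :: s)) == k by rewrite szv.
exists (Tuple szt); split=> [j|]; last first.
  by apply/(FP (Tuple szt) (szv m)).2; exists m.
apply/(proj2 (GP j) s ss).2; exists m.
rewrite (tnth_nth 0) /= (nth_map j) ?size_enum_ord // nth_ord_enum.
by have /okP/(_ j)[z ->] := okm.
Qed.

(** One stage [m] is used for the whole recursion. The factor [0 < z] in [step] propagates failure:
    once a value is missing, all later ones are missing at that stage. *)
Lemma approximates_primrec n (f : mu_code n) (g : mu_code n.+2) F G :
    approximates n F (eval f) -> approximates n.+2 G (eval g) ->
  exists F', approximates n.+1 F' (eval (PrimRec f g)).
Proof.
move=> [rF FP] [rG GP].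
pose step m s r z := (0 < z) * G [:: m, r, z.-1 & s].
pose rec m s := nat_rect (fun=> nat) (F (m :: s)) (step m s).
exists (fun s => rec (head 0 s) (behead (behead s)) (nth 0 s 1)); split.
  have r0 : recursive n.+2 (fun s => F (head 0 s :: behead (behead s))).
    exact: recursive_bump.
  (* The list holds the counter, the accumulator, the stage, the recursion argument and the
     parameters, in this order. *)
  have r1 : recursive n.+4 (fun s => (0 < nth 0 s 1) *
      G [:: nth 0 s 2, nth 0 s 0, (nth 0 s 1).-1 &
            behead (behead (behead (behead s)))]).
    apply: recursive_mul.
      exact: recursive_leq (recursive_const _ 1) (recursive_nth _).
    pose gs := [:: (fun s => nth 0 s 2), (fun s => nth 0 s 0),
      (fun s => (nth 0 s 1).-1) &
      [seq (fun s : seq nat => nth 0 s i.+4) | i <- iota 0 n]].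
    have szP : size gs = n.+3 by rewrite /= size_map size_iota.
    have: recursive n.+4 (fun s => G [seq g s | g <- gs]).
      apply: recursive_comp => [|[|[|[|j]]]]; rewrite szP //= => lt_jn;
        try apply: recursive_pred; try exact: recursive_nth.
      rewrite !ltnS in lt_jn.
      rewrite (nth_map 0) ?size_iota // nth_iota // add0n.
      exact: recursive_nth.
    apply: recursive_ext => -[|? [|? [|? [|? s]]]] //= [ss].
    congr (G [:: _, _, _ & _]); rewrite -map_comp -ss.
    exact: mkseq_nth.
  apply: recursive_ext (recursive_rect (@recursive_nth n.+2 1 isT) r0 r1).
  by move=> [|m [|x s]].
move=> [|x s] //= [ss].
have sz2 r z : size [:: r, z & s] = n.+2 by rewrite /= ss.
have mono m m' r y : m <= m' -> rec m s r = y.+1 -> rec m' s r = y.+1.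
  move=> le_mm'; elim: r y => [|r IHr] y /=.
    exact: (FP s ss).1.
  rewrite /step; case Er: (rec m s r) => [|z] //=.
  rewrite (IHr _ Er) /= !mul1n.
  exact: (GP _ (sz2 _ _)).1.
split=> [m m' y|]; first exact: mono.
elim: x => [|x IHx] y /=; first exact: (FP s ss).2.
split=> [[z [/IHx[m mP] /(GP _ (sz2 _ _)).2[m' m'P]]]|[m]].
  exists (maxn m m'); rewrite /step (mono _ _ _ _ (leq_maxl m m') mP) mul1n.
  exact: (GP _ (sz2 _ _)).1 (leq_maxr m m') m'P.
rewrite /step; case Er: (rec m s x) => [|z] //=; rewrite mul1n => Gy.
exists z; split; first by apply/IHx; exists m.
by apply/(GP _ (sz2 _ _)).2; exists m.
Qed.

(** Stage [m] searches below [m] only and judges [f] by its own stage [m]. At most one [y]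
    qualifies, so the sum is [y.+1], or 0 if there is none. *)
Lemma approximates_mu n (f : mu_code n.+1) F :
  approximates n.+1 F (eval f) -> exists F', approximates n F' (eval (Mu f)).
Proof.
move=> [rF FP].
(* Stage value 1 means that the value 0 has been found; a stage value above 1 means that a positive
   value has been found. *)
pose found m s y := (F [:: m, y & s] == 1) &&
  all (fun z => 1 < F [:: m, z & s]) (iota 0 y).
exists (fun s =>
  \sum_(y < head 0 s) found (head 0 s) (behead s) y * y.+1); split.
  have r1 : recursive n.+2 (fun s => F [:: nth 0 s 1, nth 0 s 0 & behead (behead s)]).
    have := @recursive_rename n.+2 n.+2
      (fun i => match i with 0 => 1 | 1 => 0 | i => i end) F rF.
    move=> /(_ _)/recursive_ext; apply; last by case=> [|[]].
    move=> [|x [|y s]] //= [ss]; congr (F [:: _, _ & _]).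
    rewrite -[2]/(2 + 0) iotaDl -map_comp -ss.
    exact: mkseq_nth.
  apply: (@recursive_sum n.+1 (head 0) (fun s =>
    found (nth 0 s 1) (behead (behead s)) (nth 0 s 0) * (nth 0 s 0).+1)).
    by apply: recursive_ext (@recursive_nth n.+1 0 isT) => s _; rewrite nth0.
  apply: recursive_mul; last exact/recursive_succ/recursive_nth.
  apply: recursive_and; first exact: recursive_eq r1 (recursive_const _ 1).
  have r2 := recursive_bump r1.
  (* Inside the quantifier the list begins with [z], [y], [m]. *)
  apply: (@recursive_all n.+2 (fun s => nth 0 s 0) (fun s =>
     1 < F [:: nth 0 s 2, nth 0 s 0 & behead (behead (behead s))])).
    exact: recursive_nth.
  apply: recursive_leq (recursive_const _ 2) _.
  by apply: recursive_ext r2 => -[|x [|y [|z s]]].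
move=> s ss /=.
have sz1 z : size (z :: s) = n.+1 by rewrite /= ss.
have mono m m' z y (le_mm' : m <= m') := (FP _ (sz1 z)).1 m m' y le_mm'.
have foundP m y : reflect (F [:: m, y & s] = 1 /\
    forall z, z < y -> exists u, F [:: m, z & s] = u.+2) (found m s y).
  apply: (iffP andP) => [[/eqP-> /allP Fz]|[-> Fz]]; split=> //.
    move=> z lt_zy; have := Fz z; rewrite mem_iota => /(_ lt_zy).
    by case: (F _) => [|[|u]] // _; exists u.
  by apply/allP => z; rewrite mem_iota => /Fz[u ->].
have found_uniq m y z : found m s y -> found m s z -> z = y.
  move=> /foundP[Fy ltFy] /foundP[Fz ltFz].
  case: (ltngtP y z) => // [/ltFz|/ltFy] [u]; first by rewrite Fy.
  by rewrite Fz.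
have sumP m y : \sum_(i < m) found m s i * i.+1 = y.+1 <-> y < m /\ found m s y.
  split=> [|[lt_ym fy]]; last first.
    by apply: sum_single => // z _; apply: found_uniq.
  have [/existsP[i fi]|/existsPn nf] := boolP [exists i : 'I_m, found m s i].
    rewrite (@sum_single m (found m s) S i) // => [[<-] //|z _].
    exact: found_uniq.
  by rewrite big1 // => i _; rewrite (negbTE (nf i)).
split=> [m m' y le_mm'|y].
  move=> /sumP[lt_ym /foundP[Fy Fz]]; apply/sumP.
  split; first exact: leq_trans le_mm'.
  apply/foundP; split; first exact: mono Fy.
  by move=> z /Fz[u /(mono _ _ _ _ le_mm')]; exists u.
split=> [[/(FP _ (sz1 y)).2[m0 Fy] fz]|[m /sumP[_ /foundP[Fy Fz]]]]; last first.
  split; first by apply/(FP _ (sz1 y)).2; exists m.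
  by move=> z /Fz[u Fu]; exists u; apply/(FP _ (sz1 z)).2; exists m.
have [m m' z le_mm' [u Fu]|z lt_zy|m mP] := @common_stage
    (fun m z => exists u, F [:: m, z & s] = u.+2) y.
- by exists u; apply: mono Fu.
- by have [u /(FP _ (sz1 z)).2[m Fu]] := fz z lt_zy; exists m, u.
(* [m] settles all [z < y], [m0] settles [y], and [y.+1] brings [y] below the search bound. *)
exists (maxn (maxn m m0) y.+1); apply/sumP; split; first exact: leq_maxr.
have le_m : m <= maxn (maxn m m0) y.+1 by rewrite -maxnA leq_maxl.
apply/foundP; split=> [|z /mP[u Fu]]; last by exists u; apply: mono Fu.
by apply: mono Fy; rewrite maxnAC leq_maxr.
Qed.

(** Induction on the code. The result plays the role of a normal form theorem: waiting for a
    computation to halt is replaced by testing a stage, which is total recursive. *)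
Lemma eval_approximates n (c : mu_code n) : exists F, approximates n F (eval c).
Proof.
elim: c => {n} [n||n i|n k f [F FP] g gP|n f [F FP] g [G GP]|n f [F FP]].
- by eexists; apply: approximates_total (recursive_const n 0) _.
- eexists; apply: (@approximates_total 1 (fun s => (head 0 s).+1)) => //.
  by exists Succ.
- by eexists; apply: approximates_total (recursive_nth (ltn_ord i)) _.
- have [G GP] := fin_all_exists gP.
  exact: approximates_comp FP GP.
- exact: approximates_primrec FP GP.
- exact: approximates_mu FP.
Qed.

(** * Unpairing *)

Lemma pairing_inj pr x y x' y' :
  pairing pr -> pr x y = pr x' y' -> x = x' /\ y = y'.
Proof.
by move=> [_ /bij_inj inj_pr _] /(inj_pr (x, y) (x', y'))[-> ->].
Qed.

(** Both components are bounded by the pair, so each is recovered by a bounded search with a unique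
    solution, written as a double sum. *)
Lemma unpairing pr : pairing pr -> exists l r,
  [/\ recursive 1 (fun s => l (nth 0 s 0)), recursive 1 (fun s => r (nth 0 s 0))
    & forall x y, l (pr x y) = x /\ r (pr x y) = y].
Proof.
move=> prP; have [/R2P rpr _ le_pr] := prP.
pose b z x y := pr x y == z.
exists (fun z => \sum_(x < z.+1) \sum_(y < z.+1) b z x y * x).
exists (fun z => \sum_(x < z.+1) \sum_(y < z.+1) b z x y * y).
have rb : recursive 3 (fun s => b (nth 0 s 2) (nth 0 s 1) (nth 0 s 0)).
  apply: recursive_eq; last exact: recursive_nth.
  by apply: recursive_app2 rpr _ _; apply: recursive_nth.
have r1 n : recursive n.+1 (fun s => (nth 0 s n).+1).
  exact/recursive_succ/recursive_nth.
split.
- apply: (recursive_sum (G := fun s => \sum_(y < (nth 0 s 1).+1)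
    b (nth 0 s 1) (nth 0 s 0) y * nth 0 s 0) (r1 0)).
  apply: (recursive_sum (G := fun s =>
    b (nth 0 s 2) (nth 0 s 1) (nth 0 s 0) * nth 0 s 1) (r1 1)).
  exact/recursive_mul/recursive_nth.
- apply: (recursive_sum (G := fun s => \sum_(y < (nth 0 s 1).+1)
    b (nth 0 s 1) (nth 0 s 0) y * y) (r1 0)).
  apply: (recursive_sum (G := fun s =>
    b (nth 0 s 2) (nth 0 s 1) (nth 0 s 0) * nth 0 s 0) (r1 1)).
  exact/recursive_mul/recursive_nth.
have sumE x y (w : nat -> nat -> nat) :
    \sum_(i < (pr x y).+1) \sum_(j < (pr x y).+1) b (pr x y) i j * w i j = w x y.
  have [le_x le_y] := le_pr x y.
  (* The inner sum vanishes unless [i] is [x], in which case only [j = y] contributes. *)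
  rewrite (eq_bigr (fun i : 'I_ _ => (nat_of_ord i == x) * w i y)); last first.
    move=> i _; have [->|ne_ix] := eqVneq (nat_of_ord i) x.
      rewrite mul1n.
      apply: (@sum_single _ (b (pr x y) x) (w x) y); rewrite ?ltnS /b //.
      by move=> z _ /eqP/(pairing_inj prP)[].
    rewrite big1 // => j _; rewrite /b; case: eqP => // /(pairing_inj prP)[ei _].
    by rewrite ei eqxx in ne_ix.
  apply: (@sum_single _ (fun i => i == x) (fun i => w i y)); rewrite ?ltnS //.
  by move=> z _ /eqP.
by move=> x y; rewrite (sumE x y (fun i _ => i)) (sumE x y (fun _ j => j)).
Qed.

(** * The retraction *)

(** To compute [theta i x], run through the enumeration [f] until it lists a pair with first
    component [pr i x] and positive second component; the predecessor of the latter is the value. *)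
Lemma enumerated_P2 pr theta f :
    pairing pr -> R1 f -> range f = extended_graph2 pr theta -> P2 theta.
Proof.
move=> prP /R1P rf fE; have [/R2P rpr _ _] := prP.
have [l [r [rl rr lrK]]] := unpairing prP.
(* [Mu] looks for a zero, hence the reversed truth value. Pairs with second component 0 carry no
   value and count as misses. *)
pose miss t i x := 1 - ((l (f t) == pr i x) && (0 < r (f t))).
have [cm cmP] : recursive 3 (fun s => miss (nth 0 s 0) (nth 0 s 1) (nth 0 s 2)).
  apply: recursive_sub (recursive_const _ 1) _.
  have rft : recursive 3 (fun s => f (nth 0 s 0)).
    exact: recursive_app1 rf (recursive_nth _).
  apply: recursive_and.
    apply: recursive_eq; first exact: recursive_app1 rl rft.
    by apply: recursive_app2 rpr _ _; apply: recursive_nth.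
  exact: recursive_leq (recursive_const _ 1) (recursive_app1 rr rft).
have [cv cvP] : recursive 1 (fun s => (r (f (nth 0 s 0))).-1).
  exact/recursive_pred/(recursive_app1 rr).
have missP t i x : miss t i x = 0 <-> exists2 v, theta i x = Some v
    & f t = pr (pr i x) v.+1.
  rewrite /miss; split=> [|[v _ ->]]; last by have [-> ->] := lrK (pr i x) v.+1; rewrite eqxx.
  have: range f (f t) by exists t.
  rewrite fE => -[[y [y' ->]]|[y [y' [v [tv ->]]]]].
    by have [_ ->] := lrK (pr y y') 0; rewrite andbF.
  have [-> ->] := lrK (pr y y') v.+1.
  case: eqP => // /(pairing_inj prP)[<- <-] _; by exists v.
exists (Comp cv (fun=> Mu cm)) => i x y.
have eval_miss t z : eval cm [:: t; i; x] z <-> z = miss t i x by apply: cmP.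
have missE t : exists z, miss t i x <> 0 -> eval cm [:: t; i; x] z.+1.
  by exists (miss t i x).-1 => /eqP; rewrite -lt0n => /prednK => e; apply/eval_miss.
split=> /= [txy|[t [/(_ ord0)[/eval_miss/esym/missP[v tv ftE] _] /cvP]]].
  have: exists t, miss t i x == 0.
    have: range f (pr (pr i x) y.+1) by rewrite fE; right; exists i, x, y.
    by move=> [t _ ft]; exists t; apply/eqP/missP; exists y.
  move=> /ex_minnP[t /eqP mt min_t].
  exists [tuple t]; split=> [j|].
    rewrite ord1 tnth0; split; first by apply/eval_miss; rewrite mt.
    move=> m lt_mt; have [z mz] := missE m; exists z; apply: mz => /eqP/min_t.
    by rewrite leqNgt lt_mt.
  apply/cvP => //=; have /missP[v tv ->] := mt.
  have [_ ->] := lrK (pr i x) v.+1.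
  by move: tv; rewrite txy => -[->].
rewrite size_tuple => /(_ erefl) ->.
rewrite -[nth 0 t 0](tnth_nth 0 t ord0) ftE.
by have [_ ->] := lrK (pr i x) v.+1.
Qed.

(** * Truncation of partial functions to initial segments with bounds in [A] *)

Section Retraction.

Variable A : set nat.

Definition supported (q : partial1) (x : nat) : Prop :=
  exists a, [/\ A a, x < a & forall y, y < a -> q y].

(** The map [H]. Its test is classical; effectivity enters through [cutoff_enumeration]. *)
Definition cutoff (q : partial1) : partial1 :=
  fun x => if `[< supported q x >] then q x else None.

Lemma cutoffP q x v :
  cutoff q x = Some v <-> supported q x /\ q x = Some v.
Proof.
by rewrite /cutoff; case: asboolP => [sqx|nsqx]; split=> // -[].
Qed.

Hypothesis infA : infinite_set A.

Lemma infinite_set_above n : exists2 a, A a & n < a.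
Proof.
apply/not_exists2P => An; apply: infA.
apply: (@sub_finite_set _ _ `I_n.+1); last exact: finite_II.
move=> a Aa /=; rewrite ltnS leqNgt; apply/negP => lt_na.
by case: (An a).
Qed.

Lemma cutoff_total (q : partial1) : (forall x, q x) -> cutoff q = q.
Proof.
move=> totq; apply/funext => x; rewrite /cutoff asboolT //.
by have [a Aa lt_xa] := infinite_set_above x; exists a.
Qed.

Lemma cutoff_id q : S1 A q -> cutoff q = q.
Proof.
case=> [[f [_ ->]]|qA]; first exact: cutoff_total.
apply/funext => x; rewrite /cutoff; case: asboolP => // nsx.
case E: (q x) => [v|] //; case: nsx.
have dx : pdom q x by rewrite /pdom /= E.
case: qA => [q0|[a [Aa qa]]]; first by rewrite q0 in dx.
exists a; split=> //; first by rewrite qa in dx.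
move=> y lt_ya; have: `I_a y by [].
by rewrite -qa.
Qed.

(** If [q] is not total, let [n] be its least undefined point. The segments that count are those
    whose bound [a] in [A] satisfies [a <= n]; the largest such [a] gives the domain, which is empty
    if there is none. *)
Lemma cutoff_S1 q : P1 q -> S1 A (cutoff q).
Proof.
move=> qP.
have [totq|/existsNP[n0 /negP nq0]] := pselect (forall x, q x).
  have qE : q = (fun x => Some (odflt 0 (q x))).
    by apply/funext => x; have := totq x; case: (q x).
  left; exists (fun x => odflt 0 (q x)).
  by rewrite cutoff_total // /R1 /= -qE.
right.
have: exists n, ~~ q n by exists n0.
move=> /ex_minnP[n nqn min_n].
have def_q y : y < n -> q y.
  by move=> lt_yn; apply/negPn/negP => /min_n; rewrite leqNgt lt_yn.
have le_n a : (forall y, y < a -> q y) -> a <= n.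
  by move=> qa; rewrite leqNgt; apply: contra nqn => /qa.
have pdomE x : pdom (cutoff q) x <-> supported q x.
  rewrite /pdom /= /cutoff; case: asboolP => [sx|] //; split=> // _.
  by have [a [_ lt_xa]] := sx; apply.
have [exa|noa] := pselect (exists a, `[< A a >] && (a <= n)); last first.
  left; apply/seteqP; split=> // x /pdomE[a [Aa _ /le_n le_an]].
  by case: noa; exists a; rewrite asboolT.
have ub a : `[< A a >] && (a <= n) -> a <= n by case/andP.
have [a /andP[/asboolP Aa le_an] max_a] := ex_maxnP exa ub.
right; exists a; split=> //; apply/seteqP; split=> x.
  move=> /pdomE[a' [Aa' lt_xa' /le_n le_a'n]].
  by apply: leq_trans lt_xa' _; apply: max_a; rewrite asboolT.
move=> /= lt_xa; apply/pdomE; exists a; split=> // y lt_ya.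
exact/def_q/(leq_trans lt_ya).
Qed.

(** The argument [t] codes a stage [m], a point [x] and an index [n]. The value at [x] is listed if
    stage [m] confirms [phi i] on the whole segment below [fA n] and [x] lies in it; otherwise
    [pr x 0] is listed, which belongs to every extended graph. *)
Lemma cutoff_enumeration pr phi :
    pairing pr -> computably_enumerable A -> P2 phi ->
  exists2 k, R2 k & forall i, range (k i) = extended_graph1 pr (cutoff (phi i)).
Proof.
move=> prP Ace [c cP]; have [/R2P rpr _ _] := prP.
have [l [r [rl rr lrK]]] := unpairing prP.
have [fA /R1P rfA fAE] : exists2 f, R1 f & range f = A.
  by case: Ace => [A0|[f []]]; [case: infA; rewrite A0; apply: finite_set0 | exists f].
have [F [rF FP]] := eval_approximates c.
(* Requiring [0 < m] makes stage 0 always fall back, so that [pr x 0] is listed for each [x]. *)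
pose live m i x n := [&& 0 < m, x < fA n &
  all (fun y => 0 < F [:: m; i; y]) (iota 0 (fA n))].
(* A found value [v] has stage value [v.+1], which is exactly the second component that the extended
   graph asks for. *)
pose out m i x n := pr x (live m i x n * F [:: m; i; x]).
exists (fun i t => out (l t) i (l (r t)) (r (r t))).
  apply/R2P; rewrite /out /live.
  have rt : recursive 2 (fun s => nth 0 s 1) by apply: recursive_nth.
  have rlt := recursive_app1 rl rt; have rrt := recursive_app1 rr rt.
  have rx := recursive_app1 rl rrt.
  have ra := recursive_app1 rfA (recursive_app1 rr rrt).
  have ri : recursive 2 (fun s => nth 0 s 0) by apply: recursive_nth.
  have rF3 n E1 E2 E3 : recursive n E1 -> recursive n E2 -> recursive n E3 ->
      recursive n (fun s => F [:: E1 s; E2 s; E3 s]).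
    move=> r1 r2 r3; apply: (@recursive_comp n _ [:: E1; E2; E3] rF).
    by case=> [|[|[]]].
  apply: (recursive_app2 rpr rx); apply: recursive_mul; last exact: rF3.
  apply: recursive_and; first exact: recursive_leq (recursive_const _ 1) rlt.
  apply: recursive_and; first exact: recursive_leq (recursive_succ rx) ra.
  apply: (@recursive_all 2 _ (fun s =>
     0 < F [:: l (nth 0 s 2); nth 0 s 1; nth 0 s 0]) ra).
  apply: recursive_leq (recursive_const _ 1) (rF3 _ _ _ _ _ _ _);
    try exact: recursive_nth.
  exact: recursive_app1 rl (recursive_nth _).
move=> i.
have mono x m m' y (le_mm' : m <= m') := (FP [:: i; x] erefl).1 m m' y le_mm'.
have phiP x y : phi i x = Some y <-> exists m, F [:: m; i; x] = y.+1.
  by rewrite cP; apply: (FP [:: i; x] erefl).2.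
have isoP x : phi i x <-> exists m, 0 < F [:: m; i; x].
  split=> [|[m]].
    by case E: (phi i x) => [v|] // _; have /phiP[m Fm] := E; exists m; rewrite Fm.
  case E: (F _) => [|v] // _.
  by have -> : phi i x = Some v by apply/phiP; exists m.
apply/seteqP; split=> z /=; first case=> t _ <-.
  rewrite /out; case: (boolP (live _ _ _ _)) => [lv|_]; last by left; exists (l (r t)).
  rewrite mul1n; case E: (F _) => [|v]; first by left; exists (l (r t)).
  right; exists (l (r t)), v; split=> //; apply/cutoffP; split; last first.
    by apply/phiP; exists (l t).
  case/and3P: lv => _ lt_x /allP all_y.
  exists (fA (r (r t))); split=> [||y lt_y] //; first by rewrite -fAE; exists (r (r t)).
  by apply/isoP; exists (l t); apply: all_y; rewrite mem_iota.
have outE m x n : out (l (pr m (pr x n))) i (l (r (pr m (pr x n))))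
    (r (r (pr m (pr x n)))) = out m i x n.
  by have [-> ->] := lrK m (pr x n); have [-> ->] := lrK x n.
case=> [[x _ <-]|[x [v [/cutoffP[[a [Aa lt_xa qa]] phix] ->]]]].
  by exists (pr 0 (pr x 0)); rewrite // outE /out mul0n.
have [n _ fAn] : range fA a by rewrite fAE.
have [m1 m2 y le_m|y /qa/isoP//|m mP] := @common_stage (fun m y => 0 < F [:: m; i; y]) a.
  by case E: (F _) => [|u] // _; rewrite (mono _ _ _ _ le_m E).
have /phiP[m' Fm'] := phix.
(* [m] covers the segment below [a] and [m'] the value at [x]; the successor makes the stage
   positive. *)
exists (pr (maxn m m').+1 (pr x n)) => //; rewrite outE /out.
have le_m : m <= (maxn m m').+1 by apply: leqW; apply: leq_maxl.
have -> : F [:: (maxn m m').+1; i; x] = v.+1.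
  by apply: mono Fm'; apply: leqW; apply: leq_maxr.
have -> : live (maxn m m').+1 i x n; last by rewrite mul1n.
rewrite /live fAn lt_xa /=; apply/allP => y; rewrite mem_iota => /mP.
by case E: (F [:: m; _; _]) => [|u] // _; rewrite (mono _ _ _ _ le_m E).
Qed.

End Retraction.

Theorem theorem8p7 (pr : nat -> nat -> nat) (A : set nat)
    (theta phi : nat -> partial1) :
  pairing pr ->
  infinite_set A ->
  computably_enumerable A ->
  quasi_Goedel_numbering pr A theta ->
  Goedel_numbering phi ->
  retract (S1 A) theta phi.
Proof.
move=> prP infA Ace [thetaE [f [fR fE]] qgn2] [phiE phiP2 smn].
have [g [gR gE]] := smn theta (enumerated_P2 prP fR fE).
have theta_phi : theta = phi \o g.
  by apply/funext => i; apply/funext => x; rewrite /= gE.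
(* The reduction itself shows that members of [S1 A] are partial recursive: each is some
   [phi (g i)]. *)
have S1_P1 : S1 A `<=` P1.
  by rewrite -thetaE -phiE theta_phi => _ [i _ <-]; exists (g i).
have phi_P1 i : P1 (phi i) by rewrite -phiE; exists i.
split; first by exists g.
have [k kR kE] := cutoff_enumeration infA prP Ace phiP2.
have [h [hR hE]] := qgn2 k kR.
exists (cutoff A), h; split=> //.
- apply/seteqP; split=> [_ [q qP <-]|q qS]; first exact: cutoff_S1.
  by exists q; [apply: S1_P1 | apply: cutoff_id].
(* Idempotence: [cutoff q] lies in [S1 A], whose members are fixed points. *)
- by move=> q qP; apply/(cutoff_id infA)/cutoff_S1.
- by move=> i; apply: hE (kE i); apply: cutoff_S1.
Qed.
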